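(* For every even $m\ge4$, the maps $H_0,H_1,H_2:\mathbb Z_m^3\to\mathbb Z_m^3$ defined in the context form a Hamilton decomposition of $D_3(m)$ (each $H_c$ is a permutation of $\mathbb Z_m^3$ consisting of a single cycle, and at each vertex the three maps use each of the directions $e_x,e_y,e_w$ exactly once). Their direction functions agree with those of $F_0,F_1,F_2$ (defined in the context), colour by colour, at all four points of $$Q_m=\{(0,1,0),\ (1,1,0),\ (0,0,0),\ (0,m-2,3)\}.$$
   Context: Coordinates on $\mathbb Z_m^3$ are $(x,y,w)$, with standard vectors $e_x,e_y,e_w$; $D_3(m)$ is the digraph on $\mathbb Z_m^3$ with arcs $v\to v+e_x,\ v+e_y,\ v+e_w$. Put $h=x+y+w\in\mathbb Z_m$, represented in $\{0,\dots,m-1\}$. **The factors $F_0,F_1,F_2$.** $F_c(v)=v+$ (direction of colour $c$ at $v$), with directions of $(F_0,F_1,F_2)$ at $v=(x,y,w)$: - $h=0$: $(e_w,e_y,e_x)$; - $h=1$, $w\in\{0,1\}$: $(e_x,e_w,e_y)$; - $h=1$, $w\notin\{0,1\}$: $(e_y,e_w,e_x)$; - $h=2$, $w=0$: $(e_y,e_x,e_w)$; - all other vertices: $(e_x,e_y,e_w)$. **The factors $H_0,H_1,H_2$.** On $\{0,1,2\}$ (residues mod 3) let $r(c)=c+1$ and $\tau_z(c)=2z-c$ modulo $3$. On $\mathbb Z_m^2$ let $R(a,b)=(-a-b,a)$. Define $\sigma^*:\mathbb Z_m^2\to\mathrm{Sym}(\{0,1,2\})$ by: for $z\in\{0,1,2\}$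 and $t\in\mathbb Z_m\setminus\{0\}$, $$\sigma^*(R^z(t,-t))=\begin{cases}r^{-1},&t=1,\\ r,&t=-1,\\ \tau_z,&t\notin\{0,1,-1\},\end{cases}$$ and $\sigma^*(q)=\mathrm{id}$ at all other $q$ (the three punctured lines $\{R^z(t,-t):t\neq0\}$ are pairwise disjoint). At height $h=1$ put $\sigma_{(x,y,w)}=\sigma^*(y,w-3)$. At every other height put $\sigma_{(x,y,w)}=r^{s_h}$, where: if $3\nmid m$, $s_2=1$ and $s_h=2$ for $h\notin\{1,2\}$; if $3\mid m$, $s_2=1$, $s_0=s_3=s_4=2$, and $s_h=0$ for $5\le h<m$. Let $\pi=(1\ 2)$ be the transposition of $\{0,1,2\}$ and $(e_0,e_1,e_2)=(e_x,e_y,e_w)$. Then $$H_c(x,y,w)=(x,y,w)+e_{\sigma_{(x,y,w)}(\pi(c))}\qquad(c=0,1,2).$$ *)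

(* Defs.v *)
From mathcomp Require Import all_boot all_order all_algebra all_fingroup.
Set Implicit Arguments.
Unset Strict Implicit.
Unset Printing Implicit Defensive.
Import GRing.Theory.
Local Open Scope ring_scope.

(* For m <= 1 the type 'Z_m is the ring Z/2; everything below is meant for
   m >= 4. *)
Notation vertex m := ('Z_m * 'Z_m * 'Z_m)%type.

(* Colours and directions are both residues modulo 3; the direction 0, 1, 2
   stands for e_x, e_y, e_w respectively. *)
Notation color := 'Z_3.
Notation direction := 'Z_3.
Definition dx : direction := 0.
Definition dy : direction := 1.
Definition dw : direction := 2.

Definition evec (m : nat) (d : direction) : vertex m :=
  nth 0 [:: (1, 0, 0); (0, 1, 0); (0, 0, 1)] d.

Definition D3 (m : nat) : rel (vertex m) :=
  fun u v => [exists d : direction, v == u + evec m d].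

Definition hamilton_cycle (T : finType) (arc : rel T) (f : T -> T) : Prop :=
  [/\ bijective f,
      forall u v, fconnect f u v
    & forall v, arc v (f v)].

Definition hamilton_decomposition (T : finType) (arc : rel T)
    (I : Type) (f : I -> T -> T) : Prop :=
  (forall c, hamilton_cycle arc (f c)) /\
  (forall u v, arc u v -> exists! c, f c u = v).

Definition height (m : nat) (v : vertex m) : nat :=
  let: (x, y, w) := v in (x + y + w)%R : 'Z_m.

Definition Fdir (m : nat) (c : color) (v : vertex m) : direction :=
  let: (x, y, w) := v in
  let h := height v in
  nth 0
    (if h == 0%N then [:: dw; dy; dx]
     else if h == 1%N then
       if (w == 0) || (w == 1) then [:: dx; dw; dy] else [:: dy; dw; dx]
     else if (h == 2%N) && (w == 0) then [:: dy; dx; dw]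
     else [:: dx; dy; dw]) c.

Definition F (m : nat) (c : color) (v : vertex m) : vertex m :=
  v + evec m (Fdir c v).

Definition r : {perm 'Z_3} := perm (addIr (1 : 'Z_3)).

Definition tau_fun (z c : 'Z_3) : 'Z_3 := 2 * z - c.

Lemma tau_fun_inj (z : 'Z_3) : injective (tau_fun z).
Proof. by move=> c d /addrI /oppr_inj. Qed.

Definition tau (z : 'Z_3) : {perm 'Z_3} := perm (@tau_fun_inj z).

Definition R (m : nat) (q : 'Z_m * 'Z_m) : 'Z_m * 'Z_m :=
  (- q.1 - q.2, q.1).

(* For m >= 2 the three punctured lines are pairwise disjoint and each is
   injectively parametrised by t, so at most one pair (z, t) can be picked. *)
Definition sigma_star (m : nat) (q : 'Z_m * 'Z_m) : {perm 'Z_3} :=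
  if [pick zt : 'Z_3 * 'Z_m |
        (zt.2 != 0) && (q == iter zt.1 (@R m) (zt.2, - zt.2))] is Some (z, t)
  then if t == 1 then (r^-1)%g
       else if t == -1 then r
       else tau z
  else 1%g.

(* The value at h = 1 is never used. *)
Definition shift (m h : nat) : nat :=
  if h == 2%N then 1%N
  else if ~~ (3 %| m)%N then 2%N
  else if h \in [:: 0; 3; 4]%N then 2%N
  else 0%N.

Definition sigma (m : nat) (v : vertex m) : {perm 'Z_3} :=
  let: (x, y, w) := v in
  if height v == 1%N then sigma_star (y, w - 3)
  else (r ^+ shift m (height v))%g.

Definition pi12 : {perm 'Z_3} := tperm 1 2.

Definition Hdir (m : nat) (c : color) (v : vertex m) : direction :=
  sigma v (pi12 c).

Definition H (m : nat) (c : color) (v : vertex m) : vertex m :=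
  v + evec m (Hdir c v).

Definition Q (m : nat) : seq (vertex m) :=
  [:: (0, 1, 0); (1, 1, 0); (0, 0, 0); (0, (m - 2)%N%:R, 3)].

(* Main.v *)
Require Import Defs.
From mathcomp Require Import all_boot all_order all_algebra all_fingroup.
From mathcomp Require Import zify ring.
Import Order.TTheory GRing.Theory Num.Theory.
Local Open Scope ring_scope.

(** Every step raises the height h by one, so the dynamics of H_c is that of its
    m-fold iterate on the layer h = 1, a copy of Z_m^2 with coordinates (y, w).
    At every other height the direction depends on h and c only; hence, with w
    shifted by 3 and d = pi12 c, the first return to the layer has the form
      q |-> q + proj (sigma_star q d) + drift k d,
    where k = -2 if 3 does not divide m and k = 3 otherwise ([slice_return]).
    The linear map R permutes the three lines that define sigma_star and
    conjugates the return map for d to the one for d + 1 ([sigma_star_R],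
    [R_drift]). So both injectivity and transitivity need only be proved for
    d = 0, where the return map is
      (a, b) |-> (a + 1, b + k) + detour a b.
    The detour vanishes except at 2m points: those of the two punctured axes,
    with value (1, 0) or (0, 1), and the corners (1, -1) and (-1, 1).

    Transitivity is proved through invariant functions: an injective map of a
    finite type has a single orbit if every function that is invariant under it
    is constant ([fconnect_of_invariants]). Away from the axes and the corners
    an orbit moves along lines of slope k ([drift_flow]), so it suffices to see
    how the 2m deflected points follow each other.

    Let k = -2 and m = 2n. For an invariant g, the values at (n + i, 0) and
    (n + i + 3, 0) agree; a few links at the ends of 0 <= i < n then join the
    three residue classes of i, because 3 does not divide n ([down_const]).
    Let k = 3 and m = 3n. Here the values at (2n + i, 0) and (2n + i + 2, 0)
    agree for i >= 2, and since n is even the links at the ends join the two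
    parities ([up_const]). In both cases all remaining deflected points are
    attached to these chains. *)

(** * Following a drift on the torus *)

(** The projection to (y, w) of the direction that the first colour takes at
    height 1, after the shift of w by 3, at the point with representatives
    a, b in [0, m): only the punctured axes and the corners (1, -1) and (-1, 1)
    are deflected. *)
Definition detour (m a b : int) : int * int :=
  if a == 0 then
    if b == 0 then (0, 0) else if b == m - 1 then (1, 0) else (0, 1)
  else if b == 0 then (if a == m - 1 then (0, 1) else (1, 0))
  else if (a == 1) && (b == m - 1) then (0, 1)
  else if (a == m - 1) && (b == 1) then (1, 0)
  else (0, 0).

(** An equality between two values of g records that two points lie on one
    orbit of (a, b) |-> (a, b) + (1, k) + detour a b. Working with invariant
    functions turns the pursuit of orbits, in either direction, into
    rewriting. *)
Definition drift_invariant {X : Type} (m k : int) (g : int -> int -> X) :=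
  [/\ forall a b, g (a + m) b = g a b,
      forall a b, g a (b + m) = g a b
    & forall a b : int, 0 <= a < m -> 0 <= b < m ->
        g (a + 1 + (detour m a b).1) (b + k + (detour m a b).2) = g a b].

Definition free_point (m a b : int) : bool :=
  [&& 0 < a < m, 0 < b < m, ~~ ((a == 1) && (b == m - 1))
    & ~~ ((a == m - 1) && (b == 1))].

(** No computation below leaves the fundamental square by more than one period,
    so congruence modulo m can be expressed by a linear disjunction. *)
Definition wrap (m b b' : int) : bool :=
  [|| b' == b, b' == b + m | b' == b - m].

Ltac detour_lia :=
  rewrite /detour /wrap /=; try lia;
  repeat (case: ifP => ?); first [done | exfalso; lia].

Section Drift.
Context {X : Type} {m k : int} {g : int -> int -> X}.
Hypothesis gP : drift_invariant m k g.
Hypothesis m_ge4 : 4 <= m.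

Lemma drift_wrapl (a b a' : int) : wrap m a a' -> g a b = g a' b.
Proof.
have [ga _ _] := gP; rewrite /wrap => /or3P[] /eqP-> //.
by rewrite -[in RHS]ga subrK.
Qed.

Lemma drift_wrapr (a b b' : int) : wrap m b b' -> g a b = g a b'.
Proof.
have [_ gb _] := gP; rewrite /wrap => /or3P[] /eqP-> //.
by rewrite -[in RHS]gb subrK.
Qed.

Lemma drift_step (d : int * int) (a b a' b' : int) :
    0 <= a < m -> 0 <= b < m -> detour m a b = d ->
    wrap m (a + 1 + d.1) a' -> wrap m (b + k + d.2) b' ->
  g a b = g a' b'.
Proof.
have [_ _ gs] := gP => ha hb <- ha' hb'.
by rewrite -(drift_wrapl _ _ _ ha') -(drift_wrapr _ _ _ hb') gs.
Qed.

Lemma drift_free (a b : int) : free_point m a b -> g a b = g (a + 1) (b + k).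
Proof.
by rewrite /free_point => fab; apply: (drift_step (0, 0)); detour_lia.
Qed.

Lemma drift_origin (b' : int) : wrap m k b' -> g 0 0 = g 1 b'.
Proof. by rewrite /wrap => h; apply: (drift_step (0, 0)); detour_lia. Qed.

Lemma drift_row (s a' b' : int) :
  0 < s < m - 1 -> a' = s + 2 -> wrap m k b' -> g s 0 = g a' b'.
Proof. by rewrite /wrap => hs -> h; apply: (drift_step (1, 0)); detour_lia. Qed.

Lemma drift_row_last (b' : int) : wrap m (k + 1) b' -> g (m - 1) 0 = g 0 b'.
Proof. by rewrite /wrap => h; apply: (drift_step (0, 1)); detour_lia. Qed.

Lemma drift_col (t b' : int) :
  0 < t < m - 1 -> wrap m (t + k + 1) b' -> g 0 t = g 1 b'.
Proof. by rewrite /wrap => ht h; apply: (drift_step (0, 1)); detour_lia. Qed.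

Lemma drift_col_last (b' : int) : wrap m (k - 1 + m) b' -> g 0 (m - 1) = g 2 b'.
Proof. by rewrite /wrap => h; apply: (drift_step (1, 0)); detour_lia. Qed.

Lemma drift_corner_top (b' : int) : wrap m (k + 1) b' -> g (m - 1) 1 = g 1 b'.
Proof. by rewrite /wrap => h; apply: (drift_step (1, 0)); detour_lia. Qed.

Lemma drift_corner_bot (b' : int) : wrap m (k + m) b' -> g 1 (m - 1) = g 2 b'.
Proof. by rewrite /wrap => h; apply: (drift_step (0, 1)); detour_lia. Qed.

(** Between two deflections an orbit is a straight segment of slope k. Its end
    point need not be free, and it may be written modulo m: typically the
    segment ends on the row b = 0, or just beyond it. *)
Lemma drift_flow (l a b a' b' : int) : 0 <= l ->
    (forall i : int, 0 <= i < l -> free_point m (a + i) (b + i * k)) ->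
    a' = a + l -> wrap m (b + l * k) b' ->
  g a b = g a' b'.
Proof.
case: l => // n _; elim: n a b => [|n IHn] a b fr ha hb.
  by rewrite ha addr0; apply: drift_wrapr; rewrite mul0r addr0 in hb.
rewrite (drift_free a b) //; last first.
  by have := fr 0; rewrite mul0r !addr0; apply; lia.
have eqS : b + n.+1%:Z * k = b + k + n%:Z * k.
  by rewrite -[n.+1]add1n PoszD; ring.
apply: IHn; last by rewrite -eqS.
- move=> i hi.
  have -> : a + 1 + i = a + (i + 1) by lia.
  have -> : b + k + i * k = b + (i + 1) * k by ring.
  by apply: fr; lia.
- by rewrite ha; lia.
Qed.

(** From any point, the orbit reaches an axis or a corner before a makes a full
    turn; so the values there determine g. *)
Lemma drift_const (x : X) : -m <= k <= m ->
    (forall s : int, 0 < s < m -> g s 0 = x) ->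
    (forall t : int, 0 < t < m -> g 0 t = x) ->
    g 0 0 = x -> g (m - 1) 1 = x -> g 1 (m - 1) = x ->
  forall a b : int, 0 <= a < m -> 0 <= b < m -> g a b = x.
Proof.
move=> hk gr gc g0 gB gD.
have main (n : nat) : forall a b : int,
    a = m - n%:Z -> 0 <= a < m -> 0 <= b < m -> g a b = x.
  elim: n => [|n IHn] a b an ha hb; first lia.
  have [-> | a0] := eqVneq a 0.
    by have [->|b0] := eqVneq b 0 => //; apply: gc; lia.
  have [-> | b0] := eqVneq b 0; first by apply: gr; lia.
  have [fr|nfr] := boolP (free_point m a b); last first.
    have [[-> ->]|[-> ->]] // : (a = 1 /\ b = m - 1) \/ (a = m - 1 /\ b = 1).
    by move: nfr; rewrite /free_point; lia.
  have [b' hb' eb'] : exists2 b' : int, 0 <= b' < m &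
      wrap m (b + 1 * k) b'.
    rewrite /wrap mul1r.
    have [?|?] := ltP (b + k) 0; first by exists (b + k + m); lia.
    have [?|?] := ltP (b + k) m; first by exists (b + k); lia.
    by exists (b + k - m); lia.
  rewrite (drift_flow 1 a b (a + 1) b') //.
    have [am | am] := eqVneq (a + 1) m; last by apply: IHn => //; lia.
    rewrite (drift_wrapl _ _ 0); last by rewrite /wrap; lia.
    by have [->|b'0] := eqVneq b' 0 => //; apply: gc; lia.
  by move=> i hi; have -> : i = 0 by [lia]; rewrite mul0r !addr0.
move=> a b ha hb; apply: (main `|m - a|%N) => //; lia.
Qed.
End Drift.

(** Adding its detour to each point permutes the deflected points in one cycle:
    (1, 0), ..., (m - 1, 0), (m - 1, 1), (0, 1), ..., (0, m - 1), (1, m - 1),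
    and back to (1, 0). *)
Lemma detour_inj (m a b a' b' : int) : 4 <= m ->
    0 <= a < m -> 0 <= b < m -> 0 <= a' < m -> 0 <= b' < m ->
    wrap m (a + (detour m a b).1) (a' + (detour m a' b').1) ->
    wrap m (b + (detour m a b).2) (b' + (detour m a' b').2) ->
  a = a' /\ b = b'.
Proof.
move=> m4 ha hb ha' hb'; rewrite /detour /wrap.
by do !case: ifP => ? /=; lia.
Qed.

(** * The drift (1, -2) *)

Ltac drift_lia :=
  solve [rewrite ?/wrap; lia | move=> ? ?; rewrite /free_point; lia].

(** Names of the lemmas below refer to the pieces of the deflected set: the row
    b = 0, the column a = 0, the corners. Up to [down_col_last], each lemma
    follows an orbit to its next point on an axis or at a corner. *)
Section DriftDown.
Context {X : Type} {m n : int} {g : int -> int -> X}.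
Hypothesis gP : drift_invariant m (-2) g.
Hypothesis mE : m = 2 * n.
Hypothesis n_ge2 : 2 <= n.
Hypothesis n_mod3 : ~~ (3 %| n)%Z.

Let m_ge4 : 4 <= m. Proof. lia. Qed.
Let flow := drift_flow gP m_ge4.

Lemma down_origin : g 0 0 = g n 0.
Proof.
rewrite (drift_origin gP m_ge4 (m - 2)); last drift_lia.
by apply: (flow (n - 1)); drift_lia.
Qed.

Lemma down_row_row (s s' : int) :
  1 <= s <= n - 2 -> s' = s + n + 1 -> g s 0 = g s' 0.
Proof.
move=> hs ->; rewrite (drift_row gP m_ge4 s (s + 2) (m - 2)); try drift_lia.
by apply: (flow (n - 1)); drift_lia.
Qed.

Lemma down_row_origin : g (n - 1) 0 = g 0 0.
Proof.
rewrite (drift_row gP m_ge4 (n - 1) (n + 1) (m - 2)); try drift_lia.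
rewrite -[RHS](drift_wrapl gP m); last drift_lia.
by apply: (flow (n - 1)); drift_lia.
Qed.

Lemma down_row_col (s t : int) :
  n <= s <= m - 2 -> t = 2 * s + 2 - m -> g s 0 = g 0 t.
Proof.
move=> hs ->; rewrite (drift_row gP m_ge4 s (s + 2) (m - 2)); try drift_lia.
rewrite -[RHS](drift_wrapl gP m); last drift_lia.
by apply: (flow (m - s - 2)); drift_lia.
Qed.

Lemma down_row_last : g (m - 1) 0 = g 0 (m - 1).
Proof. by apply: (drift_row_last gP m_ge4); drift_lia. Qed.

Lemma down_corners : g (m - 1) 1 = g 1 (m - 1).
Proof. by apply: (drift_corner_top gP m_ge4); drift_lia. Qed.

Lemma down_corner_row : g 1 (m - 1) = g (n + 1) 0.
Proof.
rewrite (drift_corner_bot gP m_ge4 (m - 2)); last drift_lia.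
by apply: (flow (n - 1)); drift_lia.
Qed.

(** The deflection at (0, 2j) makes b odd, and the drift then keeps it odd: b
    passes 0 twice without taking this value, and the orbit is next deflected
    in the column. *)
Lemma down_col_col (j t t' : int) :
  1 <= j <= n - 2 -> t = 2 * j -> t' = 2 * j + 1 -> g 0 t = g 0 t'.
Proof.
move=> hj -> ->.
rewrite (drift_col gP m_ge4 _ (2 * j - 1)); try drift_lia.
(* The three segments between the passages of b through 0. *)
rewrite (flow j _ _ (j + 1) (m - 1)); try drift_lia.
rewrite (flow n _ _ (j + 1 + n) (m - 1)); try drift_lia.
rewrite -[RHS](drift_wrapl gP m); last drift_lia.
by apply: (flow (n - 1 - j)); drift_lia.
Qed.

Lemma down_col_corner : g 0 (m - 2) = g (m - 1) 1.
Proof.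
rewrite (drift_col gP m_ge4 _ (m - 3)); try drift_lia.
rewrite (flow (n - 1) _ _ n (m - 1)); try drift_lia.
by apply: (flow (n - 1)); drift_lia.
Qed.

Lemma down_col_row (j t : int) :
  1 <= j <= n - 1 -> t = 2 * j - 1 -> g 0 t = g j 0.
Proof.
move=> hj ->.
rewrite (drift_col gP m_ge4 _ (2 * j - 2)); try drift_lia.
by apply: (flow (j - 1)); drift_lia.
Qed.

Lemma down_col_last : g 0 (m - 1) = g 0 1.
Proof.
rewrite (drift_col_last gP m_ge4 (m - 3)); last drift_lia.
rewrite (flow (n - 1) _ _ (n + 1) (m - 1)); try drift_lia.
rewrite -[RHS](drift_wrapl gP m); last drift_lia.
by apply: (flow (n - 1)); drift_lia.
Qed.

Lemma down_row_left (s s' : int) :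
  2 <= s <= n - 1 -> s' = s + n - 2 -> g s 0 = g s' 0.
Proof.
move=> hs ->.
rewrite -(down_col_row s (2 * s - 1)) //; last lia.
rewrite (down_row_col (s + n - 2) (2 * s - 2)); try lia.
by apply/esym/(down_col_col (s - 1)); lia.
Qed.

(** The orbit of (n + i, 0) is joined through the column to (i + 2, 0), and the
    latter continues to (n + i + 3, 0). *)
Lemma down_upper (q : nat) (i : int) :
  0 <= i -> i + 3 * q%:Z <= n - 1 -> g (n + i) 0 = g (n + i + 3 * q%:Z) 0.
Proof.
elim: q i => [|q IHq] i hi hq; first by rewrite mulr0 addr0.
rewrite -(down_row_left (i + 2)); try lia.
rewrite (down_row_row (i + 2) (n + (i + 3))); try lia.
have -> : n + i + 3 * q.+1%:Z = n + (i + 3) + 3 * q%:Z by lia.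
by apply: IHq; lia.
Qed.

(** By [down_upper] the value at (n + i, 0) depends only on i modulo 3. The ends
    of the range supply three links, of 0 with n - 3, of 2 with n - 1 and of 1
    with n - 2; they join the three classes because 3 does not divide n. For
    n = 2 the last link suffices. *)
Lemma down_upper_const (i : int) : 0 <= i <= n - 1 -> g (n + i) 0 = g n 0.
Proof.
(* Through both corners. *)
have eq_last : g (n + 1) 0 = g (n + (n - 2)) 0.
  rewrite -down_corner_row -down_corners -down_col_corner.
  by apply/esym/down_row_col; lia.
have [n2|n3] := leP n 2.
  have [-> _|i0 ?] := eqVneq i 0; first by rewrite addr0.
  have -> : n + i = n + 1 by lia.
  by rewrite eq_last; congr (g _ _); lia.
have eq0 : g n 0 = g (n + (n - 3)) 0.
  by rewrite -down_origin -down_row_origin; apply: down_row_left; lia.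
have eq2 : g (n + 2) 0 = g (n + (n - 1)) 0.
  rewrite -(down_row_row 1); try lia.
  have -> : n + (n - 1) = m - 1 by lia.
  by rewrite down_row_last down_col_last -(down_col_row 1 1) //; lia.
have red (i0 i1 : int) : 0 <= i0 -> i0 <= i1 <= n - 1 -> (3 %| i1 - i0)%Z ->
    g (n + i1) 0 = g (n + i0) 0.
  move=> h0 h1 /dvdzP[q hq].
  rewrite (down_upper `|q|%N i0); try lia.
  by congr (g _ _); lia.
have [e1 e2] : g (n + 1) 0 = g n 0 /\ g (n + 2) 0 = g n 0.
  have hn : (3 %| n - 1)%Z || (3 %| n - 2)%Z by lia.
  case/orP: hn => hn.
    split; first by rewrite eq0 (red 1 (n - 3)) //; lia.
    by rewrite eq2 (red 0 (n - 1)) ?addr0 //; lia.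
  have e2 : g (n + 2) 0 = g n 0 by rewrite eq0 (red 2 (n - 3)) //; lia.
  by split=> //; rewrite -e2 eq2 (red 1 (n - 1)) //; lia.
move=> hi.
have : [|| (3 %| i - 0)%Z, (3 %| i - 1)%Z | (3 %| i - 2)%Z] by lia.
by case/or3P=> h;
  [rewrite (red 0) ?addr0 | rewrite (red 1) | rewrite (red 2)] => //; lia.
Qed.

Lemma down_const (a b : int) : 0 <= a < m -> 0 <= b < m -> g a b = g 0 0.
Proof.
rewrite down_origin.
have row_hi (s : int) : n <= s < m -> g s 0 = g n 0.
  move=> hs; have -> : s = n + (s - n) by lia.
  by apply: down_upper_const; lia.
have row_lo (s : int) : 0 < s < n -> g s 0 = g n 0.
  move=> hs; have [s1|s1] := leP s 1; last first.
    by rewrite (down_row_left s (s + n - 2)) ?row_hi //; lia.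
  have [n2|n3] := leP n 2.
    by have -> : s = n - 1 by [lia]; rewrite down_row_origin down_origin.
  by rewrite (down_row_row s (s + n + 1)) ?row_hi //; lia.
have corner : g 1 (m - 1) = g n 0 by rewrite down_corner_row row_hi //; lia.
apply: (drift_const gP m_ge4); try lia.
- by move=> s hs; have [?|?] := ltP s n; [apply: row_lo | apply: row_hi]; lia.
- move=> t ht; have : (2 %| t)%Z || (2 %| t - 1)%Z by lia.
  case/orP=> /dvdzP[q hq].
    by rewrite -(down_row_col (n - 1 + q)) ?row_hi //; lia.
  have [?|?] := eqVneq t (m - 1); last first.
    by rewrite (down_col_row (q + 1)) ?row_lo //; lia.
  by subst t; rewrite -down_row_last row_hi //; lia.
- by rewrite down_origin.
- by rewrite down_corners.
- by [].
Qed.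
End DriftDown.

(** * The drift (1, 3) *)

Section DriftUp.
Context {X : Type} {m n : int} {g : int -> int -> X}.
Hypothesis gP : drift_invariant m 3 g.
Hypothesis mE : m = 3 * n.
Hypothesis n_ge2 : 2 <= n.
Hypothesis n_even : (2 %| n)%Z.

Let m_ge4 : 4 <= m. Proof. lia. Qed.
Let flow := drift_flow gP m_ge4.

Lemma up_origin : g 0 0 = g n 0.
Proof.
rewrite (drift_origin gP m_ge4 3); last drift_lia.
by apply: (flow (n - 1)); drift_lia.
Qed.

Lemma up_row_row (s s' : int) :
  1 <= s <= 2 * n - 2 -> s' = s + n + 1 -> g s 0 = g s' 0.
Proof.
move=> hs ->; rewrite (drift_row gP m_ge4 s (s + 2) 3); try drift_lia.
by apply: (flow (n - 1)); drift_lia.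
Qed.

Lemma up_row_origin : g (2 * n - 1) 0 = g 0 0.
Proof.
rewrite (drift_row gP m_ge4 _ (2 * n + 1) 3); try drift_lia.
rewrite -[RHS](drift_wrapl gP m); last drift_lia.
by apply: (flow (n - 1)); drift_lia.
Qed.

Lemma up_row_col (j s t : int) :
  1 <= j <= n - 1 -> s = m - 1 - j -> t = 3 * j -> g s 0 = g 0 t.
Proof.
move=> hj -> ->; rewrite (drift_row gP m_ge4 _ (m + 1 - j) 3); try drift_lia.
rewrite -[RHS](drift_wrapl gP m); last drift_lia.
by apply: (flow (j - 1)); drift_lia.
Qed.

(** A line of slope 3 along which b is not a multiple of 3 never meets the row
    b = 0; so it winds around the torus, undeflected, until it comes back to
    the column or hits a corner. The corner (-1, 1) lies on the line through
    (0, 4) and the corner (1, -1) on the line through (0, -4), whence the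
    exceptions in the next lemmas. *)
Lemma up_round (j e : int) : 0 <= j <= n - 1 -> 1 <= e <= 2 ->
  g (n - j) e = g (m - j) e.
Proof.
move=> hj he.
rewrite (flow n _ _ (2 * n - j) e); try drift_lia.
by apply: (flow n); drift_lia.
Qed.

Lemma up_round_col (j e t : int) :
  0 <= j <= n - 1 -> 1 <= e <= 2 -> t = 3 * j + e -> t != 4 ->
  g (n - j) e = g 0 t.
Proof.
move=> hj he ht t4; rewrite (up_round j e) //.
rewrite -[RHS](drift_wrapl gP m); last drift_lia.
by apply: (flow j); drift_lia.
Qed.

Lemma up_start (j e t b : int) :
  0 <= j <= n - 1 -> 1 <= e <= 2 -> t = 3 * j + e -> t != m - 4 -> b = t + 3 ->
  g 1 b = g (n - j) e.
Proof. by move=> hj he ht t4 ->; apply: (flow (n - j - 1)); drift_lia. Qed.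

Lemma up_line (t b : int) :
  0 < t < m -> ~~ (3 %| t)%Z -> t != 4 -> t != m - 4 -> b = t + 3 ->
  g 1 b = g 0 t.
Proof.
move=> ht t3 t4 t4' hb.
have [j [e [hj he tE]]] :
    exists j, exists e, [/\ 0 <= j <= n - 1, 1 <= e <= 2 & t = 3 * j + e].
  exists (t %/ 3)%Z, (t %% 3)%Z; split; lia.
by rewrite (up_start j e t) // (up_round_col j e t).
Qed.

Lemma up_col_col (t t' : int) :
  0 < t < m - 1 -> t' = t + 1 -> ~~ (3 %| t')%Z -> t' != 4 -> t' != m - 4 ->
  g 0 t = g 0 t'.
Proof.
move=> ht -> t3 t4 t4'; rewrite (drift_col gP m_ge4 _ (t + 4)); try drift_lia.
by apply: up_line; lia.
Qed.

Lemma up_col_corner_top : g 0 3 = g (m - 1) 1.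
Proof.
rewrite (drift_col gP m_ge4 _ 7); try drift_lia.
by rewrite (up_start 1 1 4) ?(up_round 1 1) //; lia.
Qed.

Lemma up_corner_top_col : g (m - 1) 1 = g 0 1.
Proof.
rewrite (drift_corner_top gP m_ge4 4); last drift_lia.
by apply: up_line; lia.
Qed.

Lemma up_col_corner_bot : g 0 (m - 5) = g 1 (m - 1).
Proof. by apply: (drift_col gP m_ge4); drift_lia. Qed.

Lemma up_corner_bot_row : g 1 (m - 1) = g (n + 1) 0.
Proof.
rewrite (drift_corner_bot gP m_ge4 3); last drift_lia.
by apply: (flow (n - 1)); drift_lia.
Qed.

Lemma up_col_row (j t s : int) :
  1 <= j <= n - 1 -> t = 3 * j - 1 -> s = n - j -> g 0 t = g s 0.
Proof.
move=> hj -> ->; rewrite (drift_col gP m_ge4 _ (3 * j + 3)); try drift_lia.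
by apply: (flow (n - j - 1)); drift_lia.
Qed.

Lemma up_col_last : g 0 (m - 1) = g 0 (m - 4).
Proof.
rewrite (drift_col_last gP m_ge4 2); last drift_lia.
have -> : 2 = n - (n - 2) by lia.
by apply: up_round_col; lia.
Qed.

Lemma up_col_triple (j : int) : 0 < j < n -> j != 1 -> j != n - 2 ->
  g 0 (3 * j) = g 0 (3 * j + 2).
Proof.
move=> hj j1 j2.
rewrite (up_col_col (3 * j) (3 * j + 1)); try lia.
by apply: up_col_col; lia.
Qed.

Lemma up_row_top (s : int) : 1 <= s <= n - 3 -> g s 0 = g (2 * n + s + 2) 0.
Proof.
move=> hs; rewrite (up_row_row s (s + n + 1)); try lia.
by apply: up_row_row; lia.
Qed.

Lemma up_row_top_last : g (n - 1) 0 = g (2 * n) 0.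
Proof. by apply: up_row_row; lia. Qed.

(** The orbit of (i, 0) visits (n + i + 1, 0) and then (2n + i + 2, 0); on the
    other hand (2n + i, 0) is joined to (i, 0) through three consecutive points
    of the column, those of [up_col_triple]. *)
Lemma up_top_step (i : int) :
  2 <= i <= n - 3 -> g (2 * n + i) 0 = g (2 * n + i + 2) 0.
Proof.
move=> hi; rewrite -up_row_top //; last lia.
rewrite (up_row_col (n - 1 - i) _ (3 * (n - 1 - i))); try lia.
rewrite up_col_triple; try lia.
by apply: (up_col_row (n - i)); lia.
Qed.

Lemma up_top_even (q : nat) (i : int) :
  2 <= i -> i + 2 * q%:Z <= n - 1 ->
  g (2 * n + i) 0 = g (2 * n + i + 2 * q%:Z) 0.
Proof.
elim: q i => [|q IHq] i hi hq; first by rewrite mulr0 addr0.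
rewrite up_top_step; last lia.
have -> : 2 * n + i + 2 * q.+1%:Z = 2 * n + (i + 2) + 2 * q%:Z by lia.
by rewrite -addrA; apply: IHq; lia.
Qed.

(** Write G_i for the value at (2n + i, 0). By [up_top_even] G_i depends only on
    the parity of i when i >= 2. Since n is even, e0 identifies G_0 with the
    even class, and e3 identifies it with the odd class; e2 takes care of G_1.
    When n = 2 there are only G_0 and G_1, linked by going through the
    corners. *)
Lemma up_top_const (i : int) : 0 <= i <= n - 1 -> g (2 * n + i) 0 = g (2 * n) 0.
Proof.
have col12 : 2 < n -> g 0 1 = g 0 2 by move=> n3; apply: up_col_col; lia.
have [n2|n3] := leP n 2.
  have [-> _|i0 ?] := eqVneq i 0; first by rewrite addr0.
  have -> : 2 * n + i = 2 + n + 1 by lia.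
  rewrite -(up_row_row 2); try lia.
  have -> : g 2 0 = g (2 * n - 1) 0.
    by rewrite up_row_origin up_origin; congr (g _ _); lia.
  have -> : 2 * n - 1 = n + 1 by lia.
  rewrite -up_corner_bot_row -up_col_corner_bot.
  have -> : m - 5 = 1 by lia.
  rewrite -up_corner_top_col -up_col_corner_top.
  by apply/esym/(up_row_col 1); lia.
have n4 : 4 <= n by lia.
have e0 : g (2 * n + (n - 2)) 0 = g (2 * n) 0.
  rewrite (up_row_col 1 _ 3); try lia.
  rewrite up_col_corner_top up_corner_top_col col12 // -up_row_top_last.
  by apply: (up_col_row 1); lia.
have e2 : g (2 * n + 1) 0 = g (2 * n + 2) 0.
  rewrite (up_row_col (n - 2) _ (m - 6)); try lia.
  rewrite (up_col_col _ (m - 5)); try lia.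
  rewrite up_col_corner_bot up_corner_bot_row.
  by apply: up_row_row; lia.
have e3 : g (2 * n) 0 = g (2 * n + 3) 0.
  rewrite (up_row_col (n - 1) _ (m - 3)); try lia.
  rewrite (up_col_col _ (m - 2)); try lia.
  rewrite (up_col_col _ (m - 1)); try lia.
  rewrite up_col_last (up_col_row (n - 1) _ 1); try lia.
  by rewrite up_row_top; last lia; congr (g _ _); lia.
have red (i0 i1 : int) : 2 <= i0 -> i0 <= i1 <= n - 1 -> (2 %| i1 - i0)%Z ->
    g (2 * n + i1) 0 = g (2 * n + i0) 0.
  move=> h0 h1 /dvdzP[q hq].
  rewrite (up_top_even `|q|%N i0); try lia.
  by congr (g _ _); lia.
have f2 : g (2 * n + 2) 0 = g (2 * n) 0.
  by rewrite -e0 (red 2 (n - 2)) //; lia.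
move=> hi.
have [->|i0] := eqVneq i 0; first by rewrite addr0.
have [->|i1] := eqVneq i 1; first by rewrite e2.
have : (2 %| i - 2)%Z || (2 %| i - 3)%Z by lia.
by case/orP=> h; [rewrite (red 2) | rewrite (red 3)] => //; lia.
Qed.

Lemma up_const (a b : int) : 0 <= a < m -> 0 <= b < m -> g a b = g (2 * n) 0.
Proof.
have row_hi (s : int) : 2 * n <= s < m -> g s 0 = g (2 * n) 0.
  move=> hs; have -> : s = 2 * n + (s - 2 * n) by lia.
  by apply: up_top_const; lia.
have row_n : g n 0 = g (2 * n) 0.
  by rewrite (up_row_row n (2 * n + 1)) ?row_hi //; lia.
have row_mid (s : int) : n <= s < 2 * n -> g s 0 = g (2 * n) 0.
  move=> hs; have [->|s1] := eqVneq s (2 * n - 1).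
    by rewrite up_row_origin up_origin.
  by rewrite (up_row_row s (s + n + 1)) ?row_hi //; lia.
have row_lo (s : int) : 0 < s < n -> g s 0 = g (2 * n) 0.
  move=> hs; have [->|s1] := eqVneq s (n - 1); first exact: up_row_top_last.
  by rewrite (up_row_row s (s + n + 1)) ?row_mid //; lia.
have corner : g 1 (m - 1) = g (2 * n) 0.
  by rewrite up_corner_bot_row row_mid //; lia.
have col2 (t : int) : 0 < t < m -> (3 %| t - 2)%Z -> g 0 t = g (2 * n) 0.
  move=> ht t3; suff main (t' : int) :
      0 < t' < m - 1 -> (3 %| t' - 2)%Z -> g 0 t' = g (2 * n) 0.
    have [->|?] := eqVneq t (m - 1); last by apply: main; lia.
    by rewrite up_col_last main //; lia.
  move=> ht' /dvdzP[q hq].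
  by rewrite (up_col_row (q + 1) _ (n - (q + 1))) ?row_lo //; lia.
have col1 (t : int) : 0 < t < m -> (3 %| t - 1)%Z -> g 0 t = g (2 * n) 0.
  move=> ht t3; have [->|?] := eqVneq t (m - 5).
    by rewrite up_col_corner_bot corner.
  by rewrite (up_col_col t (t + 1)) ?col2 //; lia.
apply: (drift_const gP m_ge4); try lia.
- move=> s hs; have [?|?] := ltP s n; first by apply: row_lo; lia.
  by have [?|?] := ltP s (2 * n); [apply: row_mid | apply: row_hi]; lia.
- move=> t ht; have : [|| (3 %| t)%Z, (3 %| t - 1)%Z | (3 %| t - 2)%Z] by lia.
  case/or3P=> h; [ | exact: col1 | exact: col2].
  have [q hq] := dvdzP h.
  by rewrite -(up_row_col q (m - 1 - q)) ?row_hi //; lia.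
- by rewrite up_origin.
- by rewrite up_corner_top_col col1 //; lia.
- by [].
Qed.
End DriftUp.

(** * The return map to height 1 and its symmetry *)

(** The canonical representative of the orbit of x is an invariant function of
    x. *)
Lemma fconnect_of_invariants (T : finType) (f : T -> T) : injective f ->
    (forall g : T -> T, (forall x, g (f x) = g x) -> forall x y, g x = g y) ->
  forall x y, fconnect f x y.
Proof.
move=> f_inj inv x y; have sym := fconnect_sym f_inj.
apply/(fingraph.rootP sym)/inv => z; apply/esym/(fingraph.rootP sym).
exact: fconnect1.
Qed.

Lemma Z3P (d : 'Z_3) : [\/ d = 0, d = 1 | d = 2].
Proof.
by case: d => [[|[|[|]]]] //= ?;
  [constructor 1 | constructor 2 | constructor 3]; apply: val_inj.
Qed.

Lemma Z3S0 : 0 + 1 = 1 :> 'Z_3. Proof. exact: val_inj. Qed.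
Lemma Z3S1 : 1 + 1 = 2 :> 'Z_3. Proof. exact: val_inj. Qed.
Lemma Z3S2 : 2 + 1 = 0 :> 'Z_3. Proof. exact: val_inj. Qed.

Lemma Z3_rect_shift (P : 'Z_3 -> Prop) :
  P 0 -> (forall c, P c -> P (c + 1)) -> forall c, P c.
Proof.
move=> P0 PS c.
have P1 : P 1 by rewrite -Z3S0; apply: PS.
have P2 : P 2 by rewrite -Z3S1; apply: PS.
by case: (Z3P c) => ->.
Qed.

(** Layers of constant height are identified with Z_m^2 by (y, w). *)
Definition proj (m : nat) (d : direction) : 'Z_m * 'Z_m :=
  ((evec m d).1.2, (evec m d).2).

(** The slope of the return map for d = 0: among the m - 1 layers with h != 1,
    those where this colour moves along e_w number m - 2 = -2 (modulo m) if 3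
    does not divide m, and 3 otherwise. *)
Definition drift_coef (m : nat) : int := if (3 %| m)%N then 3 else -2.

Section Residues.
Context {m : nat}.
Hypothesis m_ge4 : (4 <= m)%N.

Let m_gt1 : (1 < m)%N. Proof. exact: leq_trans m_ge4. Qed.

Lemma Zm_natr0 : m%:R = 0 :> 'Z_m.
Proof. exact: pchar_Zp. Qed.

Lemma Zm_intr0 : (m%:Z)%:~R = 0 :> 'Z_m.
Proof. exact: Zm_natr0. Qed.

Lemma Zm_rep (x : 'Z_m) : exists2 a : int, 0 <= a < m%:Z & x = a%:~R.
Proof.
exists (x : nat)%:Z; last by rewrite -[LHS]natr_Zp.
have := ltn_ord x; rewrite [X in (_ < X)%N](Zp_cast m_gt1); lia.
Qed.

Lemma Zm_intr_eq0 (a : int) : (a%:~R == 0 :> 'Z_m) = (m%:Z %| a)%Z.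
Proof.
have m0 : m%:Z != 0 by lia.
rewrite {1}(divz_eq a m%:Z) rmorphD rmorphM /= Zm_intr0 mulr0 add0r.
rewrite (sameP dvdz_mod0P eqP).
have := modz_ge0 a m0.
have : (a %% m%:Z)%Z < m%:Z by apply: ltz_pmod; lia.
case: (a %% m)%Z => // k; rewrite ltz_nat => km _.
rewrite -[_%:~R]/(k%:R) -val_eqE /= -[X in _ == X]/0%N.
rewrite val_Zp_nat // modn_small //.
Qed.

Lemma Zm_intr_eq (a b : int) :
  0 <= a < m%:Z -> 0 <= b < m%:Z -> (a%:~R == b%:~R :> 'Z_m) = (a == b).
Proof.
move=> ha hb; rewrite -subr_eq0 -rmorphB Zm_intr_eq0.
apply/idP/eqP => [/dvdzP[q hq]|->]; last by rewrite subrr dvdz0.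
by have [q0|q0|q0] := ltgtP q 0; [nia | nia | subst q; lia].
Qed.

Lemma Zm_N1 : -1 = (m%:Z - 1)%:~R :> 'Z_m.
Proof. by rewrite rmorphB /= Zm_intr0 sub0r. Qed.

Lemma Zm_eq0 (a : int) : 0 <= a < m%:Z -> (a%:~R == 0 :> 'Z_m) = (a == 0).
Proof. by move=> ha; rewrite (Zm_intr_eq a 0) //; lia. Qed.

Lemma Zm_eq1 (a : int) : 0 <= a < m%:Z -> (a%:~R == 1 :> 'Z_m) = (a == 1).
Proof. by move=> ha; rewrite (Zm_intr_eq a 1) //; lia. Qed.

Lemma Zm_eqN1 (a : int) :
  0 <= a < m%:Z -> (a%:~R == -1 :> 'Z_m) = (a == m%:Z - 1).
Proof. by move=> ha; rewrite Zm_N1 Zm_intr_eq //; lia. Qed.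

Lemma Zm_eqN (a b : int) : 0 <= a < m%:Z -> 0 <= b < m%:Z ->
  (a%:~R + b%:~R == 0 :> 'Z_m) = (a + b == 0) || (a + b == m%:Z).
Proof.
move=> ha hb; rewrite -rmorphD Zm_intr_eq0.
apply/idP/idP => [/dvdzP[q hq]|/orP[]/eqP->]; [ | exact: dvdz0 | exact: dvdzz].
have [q0|q0|q0] := ltgtP q 0; [nia | | subst q; lia].
by have [q1|q1|q1] := ltgtP q 1; [lia | nia | subst q; lia].
Qed.

Lemma pairD (a b c d : 'Z_m) : (a, b) + (c, d) = (a + c, b + d).
Proof. by []. Qed.

Definition line_perm (z : 'Z_3) (t : 'Z_m) : {perm 'Z_3} :=
  if t == 1 then (r^-1)%g else if t == -1 then r else tau z.

Lemma R_iter (z : 'Z_3) (t : 'Z_m) :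
  iter z (@R m) (t, - t) =
    nth 0 [:: (t, - t); (0, t); (- t, 0)] z.
Proof. by case: (Z3P z) => -> //=; rewrite /R /=; congr pair; ring. Qed.

(** The two coordinates reveal the line on which a point lies and its parameter
    there, so the value does not depend on the pair that is picked. *)
Lemma sigma_starE (a b : 'Z_m) : sigma_star (a, b) =
  if a == 0 then (if b == 0 then 1%g else line_perm 1 b)
  else if b == 0 then line_perm 2 (- a)
  else if a + b == 0 then line_perm 0 a else 1%g.
Proof.
rewrite /sigma_star; case: pickP => [[z t] /= /andP[t0 /eqP]|noline].
  rewrite R_iter -/(line_perm z t) => q.
  by case: (Z3P z) q => -> /= [-> ->];
    rewrite ?oppr_eq0 ?eqxx ?(negPf t0) ?opprK ?subrr ?eqxx.
have line (z : 'Z_3) (t : 'Z_m) :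
    t != 0 -> (a, b) != nth 0 [:: (t, - t); (0, t); (- t, 0)] z.
  by move=> t0; have := noline (z, t); rewrite /= t0 R_iter /= => ->.
case: eqVneq => [a0|a0].
  case: eqVneq => // b0; have := line 1 b b0; by rewrite a0 eqxx.
case: eqVneq => [b0|b0].
  by have := line 2 (- a); rewrite oppr_eq0 b0 opprK eqxx => /(_ a0).
case: eqVneq => // /eqP; rewrite addrC addr_eq0 => /eqP ab.
by have := line 0 a a0; rewrite ab eqxx.
Qed.

Lemma rV (c : 'Z_3) : (r^-1)%g c = c - 1.
Proof. by apply: (@perm_inj _ r); rewrite permKV permE subrK. Qed.

(** Conjugation by r fixes r and maps tau z to tau (z + 1). *)
Lemma line_perm_shift (z : 'Z_3) (t : 'Z_m) (c : 'Z_3) :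
  line_perm (z + 1) t (c + 1) = line_perm z t c + 1.
Proof.
by rewrite /line_perm; do 2?case: ifP => _; rewrite ?rV ?permE /tau_fun; ring.
Qed.

(** R permutes the three lines cyclically and keeps the parameter t. *)
Lemma sigma_star_R (q : 'Z_m * 'Z_m) (c : 'Z_3) :
  sigma_star (R q) (c + 1) = sigma_star q c + 1.
Proof.
case: q => a b; rewrite /R /= !sigma_starE.
have -> : - a - b + a = - b by ring.
rewrite -opprD !oppr_eq0 opprK.
have [->|a0] := eqVneq a 0; have [->|b0] := eqVneq b 0;
  rewrite ?(add0r, addr0) ?eqxx ?(negPf a0) ?(negPf b0) ?perm1;
  rewrite -?line_perm_shift //.
  by rewrite (_ : 2 + 1 = 0) //; apply: val_inj.
by case: eqP => _; rewrite ?perm1 // -line_perm_shift add0r.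
Qed.

Lemma proj0 : proj m 0 = (0, 0). Proof. by []. Qed.
Lemma proj1 : proj m 1 = (1, 0). Proof. by []. Qed.
Lemma proj2 : proj m 2 = (0, 1). Proof. by []. Qed.
Lemma pairB (a b c d : 'Z_m) : (a, b) - (c, d) = (a - c, b - d).
Proof. by []. Qed.

(** The vector proj d represents e_d - e_x in the plane x + y + w = 0, where R is
    the cyclic shift of coordinates; the shift gives e_(d + 1) - e_y, hence the
    correction by proj 1. It cancels against the one in [R_drift]. *)
Lemma R_proj (d : 'Z_3) : R (proj m d) = proj m (d + 1) - (1, 0).
Proof.
case: (Z3P d) => ->; rewrite ?Z3S0 ?Z3S1 ?Z3S2 ?proj0 ?proj1 ?proj2 pairB /R /=.
all: by congr pair; ring.
Qed.

Lemma RD (p q : 'Z_m * 'Z_m) : R (p + q) = R p + R q.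
Proof.
by case: p q => [a b] [c d]; rewrite pairD /R pairD /=; congr pair; ring.
Qed.

End Residues.

Section ReturnMap.
Context {m : nat}.
Hypothesis m_ge4 : (4 <= m)%N.

Definition hop (c : 'Z_3) (q : 'Z_m * 'Z_m) := q + proj m (sigma_star q c).

Lemma sigma_star0_detour (a b : int) : 0 <= a < m%:Z -> 0 <= b < m%:Z ->
  proj m (@sigma_star m (a%:~R, b%:~R) 0) =
    ((detour m a b).1%:~R, (detour m a b).2%:~R).
Proof.
move=> ha hb; rewrite sigma_starE /line_perm /detour.
have rV0 : (r^-1)%g 0 = 2 by rewrite rV; apply: val_inj.
have r0 : r 0 = 1 by rewrite permE; apply: val_inj.
have tau1 : tau 1 0 = 2 by rewrite permE; apply: val_inj.
have tau2 : tau 2 0 = 1 by rewrite permE; apply: val_inj.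
have tau0 : tau 0 0 = 0 by rewrite permE; apply: val_inj.
rewrite -(Zm_eq0 m_ge4 _ ha) -(Zm_eq0 m_ge4 _ hb).
rewrite eqr_opp eqr_oppLR.
rewrite Zm_eqN // !(Zm_eq0, Zm_eq1, Zm_eqN1) //.
by do !case: ifP => ?;
  rewrite ?perm1 ?(rV0, r0, tau0, tau1, tau2) ?(proj0, proj1, proj2) //;
  exfalso; lia.
Qed.

Lemma intr_wrap (a b : int) : 0 <= a <= m%:Z -> 0 <= b <= m%:Z ->
  a%:~R = b%:~R :> 'Z_m -> wrap m a b.
Proof.
move=> ha hb /eqP; rewrite -subr_eq0 -rmorphB Zm_intr_eq0 // => /dvdzP[q hq].
rewrite /wrap.
have [q0|q0|q0] := ltgtP q 0; last by subst q; lia.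
  by have [q1|q1|q1] := ltgtP q (-1); [nia | lia | subst q; lia].
by have [q1|q1|q1] := ltgtP q 1; [lia | nia | subst q; lia].
Qed.

Lemma hop0_inj : injective (hop 0).
Proof.
move=> [x y] [x' y'].
have [[a ha ->] [b hb ->]] := (Zm_rep m_ge4 x, Zm_rep m_ge4 y).
have [[a' ha' ->] [b' hb' ->]] := (Zm_rep m_ge4 x', Zm_rep m_ge4 y').
rewrite /hop !sigma_star0_detour // !pairD -!rmorphD => -[ea eb].
have bnd c d : [/\ 0 <= (detour m c d).1 <= 1 & 0 <= (detour m c d).2 <= 1].
  by rewrite /detour; do !case: ifP => _; split.
have [[d1 d2] [d1' d2']] := (bnd a b, bnd a' b').
by have [|||||||-> ->] := @detour_inj m a b a' b'; rewrite ?intr_wrap //; lia.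
Qed.

Lemma R_hop (c : 'Z_3) (q : 'Z_m * 'Z_m) :
  R (hop c q) = hop (c + 1) (R q) - (1, 0).
Proof. by rewrite /hop RD R_proj sigma_star_R // addrA. Qed.

Lemma R3 (q : 'Z_m * 'Z_m) : R (R (R q)) = q.
Proof. by case: q => a b; rewrite /R /=; congr pair; ring. Qed.

(** R conjugates hop c to hop (c + 1) up to a translation. *)
Lemma hop_inj (c : 'Z_3) : injective (hop c).
Proof.
elim/Z3_rect_shift: c => [|c IHc]; first exact: hop0_inj.
move=> q q' eqq.
have R_inj : injective (@R m) by move=> p p' e; rewrite -[p]R3 e R3.
rewrite -[q]R3 -[q']R3; congr R; apply/IHc/R_inj.
by rewrite !R_hop !R3 eqq.
Qed.

(** The translation collected between two visits of height 1; the three entries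
    correspond under R, as [R_drift] states. *)
Definition drift (k : int) (c : 'Z_3) : 'Z_m * 'Z_m :=
  nth 0 [:: (1, k%:~R); (- k%:~R - 2, 1); (k%:~R, - k%:~R - 2)] c.

Lemma R_drift (k : int) (c : 'Z_3) : R (drift k c) = drift k (c + 1) + (1, 0).
Proof.
by case: (Z3P c) => ->; rewrite ?Z3S0 ?Z3S1 ?Z3S2 pairD /R /=; congr pair; ring.
Qed.

(** Transitivity of the return map, in terms of invariant functions. *)
Definition transitive_drift (k : int) (c : 'Z_3) :=
  forall (X : Type) (f : 'Z_m * 'Z_m -> X),
    (forall q, f (hop c q + drift k c) = f q) -> forall q q', f q = f q'.

Lemma transitive_drift_shift (k : int) (c : 'Z_3) :
  transitive_drift k 0 -> transitive_drift k c.
Proof.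
move=> t0; elim/Z3_rect_shift: c => // c IHc X f fP q q'.
suff fR p : f (R p) = f (R (R (R q))) by rewrite -[q']R3 fR R3.
apply: (IHc X (fun p => f (R p))) => {}p.
by rewrite RD R_hop R_drift addrACA addNr addr0 fP.
Qed.

Lemma drift_invariant_intr (X : Type) (k : int) (f : 'Z_m * 'Z_m -> X) :
    (forall q, f (hop 0 q + drift k 0) = f q) ->
  drift_invariant m k (fun a b => f (a%:~R, b%:~R)).
Proof.
move=> fP; split=> a b; rewrite ?rmorphD /= ?(Zm_intr0 m_ge4) ?addr0 // => ha hb.
rewrite -[RHS]fP /hop sigma_star0_detour // !pairD.
by congr (f (_, _)); rewrite ?rmorphD /=; ring.
Qed.

Lemma transitive_drift_of_const (k : int) :
    (forall (X : Type) (g : int -> int -> X), drift_invariant m k g ->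
      exists x, forall a b : int,
        0 <= a < m%:Z -> 0 <= b < m%:Z -> g a b = x) ->
  forall c, transitive_drift k c.
Proof.
move=> H c; apply: transitive_drift_shift => X f /drift_invariant_intr/H[x fx].
have {}fx q : f q = x.
  case: q => u v.
  by have [[a ha ->] [b hb ->]] := (Zm_rep m_ge4 u, Zm_rep m_ge4 v); rewrite fx.
by move=> q q'; rewrite !fx.
Qed.

Lemma transitive_drift_coef (c : 'Z_3) :
  ~~ odd m -> transitive_drift (drift_coef m) c.
Proof.
move=> m_even; apply: transitive_drift_of_const => X g; rewrite /drift_coef.
case: ifP => m3 gP.
  exists (g (2 * (m %/ 3)%N%:Z) 0); apply: (up_const gP); lia.
by exists (g 0 0); apply: (@down_const _ _ (m %/ 2)%N%:Z _ gP); lia.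
Qed.

End ReturnMap.

(** * Layers of constant height *)

Lemma rX (s : nat) (c : 'Z_3) : (r ^+ s)%g c = c + s%:R.
Proof.
elim: s => [|s IHs]; first by rewrite expg0 perm1 addr0.
by rewrite expgSr permM IHs permE -natr1 addrA.
Qed.

Section Slices.
Context {m : nat}.
Hypothesis m_ge4 : (4 <= m)%N.

Let m_gt1 : (1 < m)%N. Proof. exact: leq_trans m_ge4. Qed.

Definition vertex_at (h : 'Z_m) (q : 'Z_m * 'Z_m) : vertex m :=
  (h - q.1 - q.2, q.1, q.2).

Lemma vertex_atP (v : vertex m) :
  v = vertex_at (v.1.1 + v.1.2 + v.2) (v.1.2, v.2).
Proof. by case: v => [[x y] w]; rewrite /vertex_at /=; congr (_, _, _); ring. Qed.

Lemma height_vertex_at (h : 'Z_m) (q : 'Z_m * 'Z_m) : height (vertex_at h q) = h.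
Proof. by rewrite /height /vertex_at; congr nat_of_ord; ring. Qed.

Lemma vertex_at_evec (h : 'Z_m) (q : 'Z_m * 'Z_m) (d : 'Z_3) :
  vertex_at h q + evec m d = vertex_at (h + 1) (q + proj m d).
Proof.
case: q => a b.
case: (Z3P d) => ->; rewrite ?proj0 ?proj1 ?proj2 pairD /vertex_at /=.
all: by rewrite /evec /=; congr (_, _, _); rewrite /=; ring.
Qed.

Lemma vertex_at_inj (h h' : 'Z_m) (q q' : 'Z_m * 'Z_m) :
  vertex_at h q = vertex_at h' q' -> h = h' /\ q = q'.
Proof.
move=> e; have eq_q : q = q'.
  apply/eqP; rewrite -pair_eqE /pair_eq; apply/andP; split; apply/eqP.
    exact: (congr1 (fun v : vertex m => v.1.2) e).
  exact: (congr1 (fun v : vertex m => v.2) e).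
split=> //; move: (congr1 (fun v : vertex m => v.1.1) e).
by rewrite eq_q /= => /addIr/addIr.
Qed.

Lemma sigma_vertex_at (h : 'Z_m) (q : 'Z_m * 'Z_m) :
  sigma (vertex_at h q) =
    if (h : nat) == 1%N then sigma_star (q - (0, 3)) else (r ^+ shift m h)%g.
Proof.
rewrite /sigma -[LHS]/(if height (vertex_at h q) == 1%N then _ else _).
rewrite height_vertex_at.
by case: q => a b; rewrite pairB subr0.
Qed.

Lemma H_vertex_at (c : color) (h : 'Z_m) (q : 'Z_m * 'Z_m) :
  H c (vertex_at h q) =
    vertex_at (h + 1) (q + proj m (sigma (vertex_at h q) (pi12 c))).
Proof. by rewrite /H vertex_at_evec. Qed.

Lemma H_inj (c : color) : injective (@H m c).
Proof.
move=> v v'; rewrite (vertex_atP v) (vertex_atP v') !H_vertex_at.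
move: (_ + v.2) (_ + v'.2) (_, v.2) (_, v'.2) => h h' q q'.
move=> /vertex_at_inj[/addIr <-].
rewrite !sigma_vertex_at; case: ifP => _ eq_q; last by move/addIr: eq_q => ->.
suff /addIr-> : q - (0, 3) = q' - (0, 3) by [].
by apply: (hop_inj m_ge4 (pi12 c)); rewrite /hop addrAC eq_q addrAC.
Qed.

Lemma val_natr (n : nat) : (n%:R : 'Z_m) = (n %% m)%N :> nat.
Proof. by rewrite val_Zp_nat. Qed.

Section Invariant.
Context {X : Type} {c : color} {G : vertex m -> X}.
Hypothesis GP : forall v, G (H c v) = G v.

(** Across consecutive layers that all use the power r^s the direction is
    constant. *)
Lemma slice_run (n h s : nat) (q : 'Z_m * 'Z_m) :
    (forall i, (i < n)%N ->
       ((h + i) %% m)%N != 1%N /\ shift m ((h + i) %% m) = s) ->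
  G (vertex_at (h + n)%:R (q + proj m (pi12 c + s%:R) *+ n)) =
  G (vertex_at h%:R q).
Proof.
elim: n => [|n IHn] hs; first by rewrite addn0 addr0.
have [h1 sh] := hs n (ltnSn n).
rewrite -IHn; last by move=> i hi; apply/hs/ltnW.
rewrite -[RHS]GP H_vertex_at sigma_vertex_at val_natr (negPf h1) sh rX.
by rewrite addnS -natr1 mulrSr addrA.
Qed.

Lemma pairMn (a b : 'Z_m) (n : nat) : (a, b) *+ n = (a *+ n, b *+ n).
Proof. by elim: n => // n IHn; rewrite !mulrS IHn. Qed.

Lemma shift_ge3 (h : nat) : (3 <= h < m)%N ->
  shift m h = if (3 %| m)%N && (5 <= h)%N then 0%N else 2%N.
Proof.
move=> hh; rewrite /shift !inE.
by do !case: ifP => //; lia.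
Qed.

Lemma shift0 : shift m 0 = 2%N.
Proof. by rewrite /shift; case: ifP. Qed.

(** The layer h = 2 uses r. The other m - 2 layers with h != 1 all use r^2 when 3
    does not divide m; otherwise three of them use r^2 and m - 5 use the
    identity. In Z_m the multiplicities m - 2 and m - 5 are -2 and -5. *)
Lemma drift_coefE (d : 'Z_3) : drift (drift_coef m) d =
  proj m (d + 1) +
    if (3 %| m)%N then proj m (d + 2) *+ 3 + proj m d *+ (m - 5)
    else proj m (d + 2) *+ (m - 2).
Proof.
have zS2 : 1 + 2 = 0 :> 'Z_3 by apply: val_inj.
have zS3 : 2 + 2 = 1 :> 'Z_3 by apply: val_inj.
have m0 := Zm_natr0 m_ge4.
have m2 : (m - 2)%:R = -2 :> 'Z_m by rewrite natrB ?m0 ?sub0r //; lia.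
rewrite /drift_coef; case: ifP => m3.
  have m5 : (m - 5)%:R = -5 :> 'Z_m by rewrite natrB ?m0 ?sub0r //; lia.
  case: (Z3P d) => ->;
    rewrite ?Z3S0 ?Z3S1 ?Z3S2 ?add0r ?zS2 ?zS3 ?proj0 ?proj1 ?proj2;
    rewrite ?pairMn ?pairD ?mul0rn ?m5 /drift /=; congr pair; ring.
case: (Z3P d) => ->;
  rewrite ?Z3S0 ?Z3S1 ?Z3S2 ?add0r ?zS2 ?zS3 ?proj0 ?proj1 ?proj2;
  rewrite ?pairMn ?pairD ?mul0rn ?m2 /drift /=; congr pair; ring.
Qed.

(** The journey from height 2 round to height 1. *)
Lemma slice_turn (q : 'Z_m * 'Z_m) :
  G (vertex_at 1 (q + drift (drift_coef m) (pi12 c))) = G (vertex_at 2 q).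
Proof.
have m0 := Zm_natr0 m_ge4.
have e1 (n : nat) : n = (m + 1)%N -> n%:R = 1 :> 'Z_m.
  by move=> ->; rewrite natrD m0 add0r.
have run2 (p : 'Z_m * 'Z_m) :
    G (vertex_at 3 (p + proj m (pi12 c + 1))) = G (vertex_at 2 p).
  apply: etrans (@slice_run 1 2 1 p _); first by rewrite mulr1n.
  by move=> [] // _; rewrite addn0 modn_small //; apply: leq_trans m_ge4.
rewrite -run2 drift_coefE addrA; move: (q + proj m _) => {}q.
case: ifP => m3; last first.
  apply: etrans (@slice_run (m - 2) 3 2 q _); first by rewrite e1 //; lia.
  move=> i hi; have [hm|hm] := ltnP (3 + i) m.
    rewrite modn_small //; split; first lia.
    by rewrite shift_ge3 ?m3 //; lia.
  by have -> : (3 + i = m)%N by [lia]; rewrite modnn shift0.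
have m6 : (6 <= m)%N by lia.
apply: etrans (@slice_run 2 3 2 q _); last first.
  move=> i hi; rewrite modn_small; last lia.
  by split; [lia | rewrite shift_ge3 ?m3; [rewrite ifF; lia | lia]].
apply: etrans (@slice_run (m - 5) 5 0 _ _); last first.
  move=> i hi; rewrite modn_small; last lia.
  by split; [lia | rewrite shift_ge3 ?m3 //; lia].
apply: etrans (@slice_run 1 (5 + (m - 5)) 2 _ _); last first.
  by move=> [] // _; rewrite addn0 subnKC ?modnn ?shift0 //; lia.
rewrite e1 ?addr0 ?mulr1n; last lia.
congr (G (vertex_at _ _)).
by rewrite [X in q + (X + _)]mulrSr -!addrA; do 3!congr (_ + _); apply: addrC.
Qed.

Lemma slice_return (q : 'Z_m * 'Z_m) :
  G (vertex_at 1 (hop (pi12 c) q + drift (drift_coef m) (pi12 c) + (0, 3))) =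
  G (vertex_at 1 (q + (0, 3))).
Proof.
rewrite addrAC slice_turn -[RHS]GP H_vertex_at sigma_vertex_at.
have -> : (nat_of_ord (1%R : 'Z_m) == 1)%N.
  by rewrite -[1]/(1%:R) val_natr modn_small.
by rewrite addrK -[1 + 1]/2%:R /hop addrAC.
Qed.

Lemma slice1_const (q q' : 'Z_m * 'Z_m) :
  ~~ odd m -> G (vertex_at 1 q) = G (vertex_at 1 q').
Proof.
move=> m_even; rewrite -[q](subrK (0, 3)) -[q'](subrK (0, 3)).
pose f (p : 'Z_m * 'Z_m) := G (vertex_at 1 (p + (0, 3))).
apply: (transitive_drift_coef m_ge4 (pi12 c) m_even _ f).
exact: slice_return.
Qed.

(** Invariance carries a constant value on the layer 1 backwards to the layers
    0, -1, and so on. *)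
Lemma invariant_const (v v' : vertex m) : ~~ odd m -> G v = G v'.
Proof.
move=> m_even; pose x := G (vertex_at 1 0).
suff {v v'} Gx v : G v = x by rewrite !Gx.
have below (n : nat) q : G (vertex_at (1 - n%:R) q) = x.
  elim: n q => [|n IHn] q; first by rewrite subr0; apply: slice1_const.
  by rewrite -GP H_vertex_at -natr1 opprD addrA subrK IHn.
rewrite (vertex_atP v); move: (_ + v.2) (_, v.2) => h q.
have -> : h = 1 - (nat_of_ord (1 - h))%:R by rewrite natr_Zp subKr.
exact: below.
Qed.

End Invariant.

Lemma H_connected (c : color) (u v : vertex m) : ~~ odd m -> fconnect (H c) u v.
Proof.
move=> m_even; apply: fconnect_of_invariants; first exact: H_inj.
by move=> g gP x y; apply: (invariant_const (c := c) gP).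
Qed.

Lemma evec_inj : injective (evec m).
Proof.
by move=> d d'; case: (Z3P d) => ->; case: (Z3P d') => -> // [].
Qed.

Lemma H_color (v : vertex m) (d : direction) :
  exists! c : color, H c v = v + evec m d.
Proof.
exists (pi12 ((sigma v)^-1%g d)); split.
  by rewrite /H /Hdir tpermK permKV.
by move=> c /addrI/evec_inj <-; rewrite /Hdir permK tpermK.
Qed.

Lemma Fdir_vertex_at (c : color) (h : 'Z_m) (q : 'Z_m * 'Z_m) :
  Fdir c (vertex_at h q) = nth 0
    (if (h : nat) == 0%N then [:: dw; dy; dx]
     else if (h : nat) == 1%N then
       if (q.2 == 0) || (q.2 == 1) then [:: dx; dw; dy] else [:: dy; dw; dx]
     else if ((h : nat) == 2%N) && (q.2 == 0) then [:: dy; dx; dw]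
     else [:: dx; dy; dw]) c.
Proof. by rewrite -(height_vertex_at h q). Qed.

Lemma agree_on_Q (c : color) (v : vertex m) : v \in Q m -> Hdir c v = Fdir c v.
Proof.
have m0 := Zm_natr0 m_ge4.
have val1 : nat_of_ord (1 : 'Z_m) = 1%N.
  by rewrite -[1 : 'Z_m]/(1%:R) val_natr modn_small.
have val2 : nat_of_ord (2 : 'Z_m) = 2%N by rewrite val_natr modn_small //; lia.
have pi0 : pi12 0 = 0 by rewrite permE.
have pi1 : pi12 1 = 2 by rewrite permE.
have pi2 : pi12 2 = 1 by rewrite permE.
have rot z c' d : c' + z%:R = d -> (r ^+ z)%g c' = d by rewrite rX.
have n10 : (1 == 0 :> 'Z_m) = false by [].
have n20 : (2 == 0 :> 'Z_m) = false by apply: etrans (Zm_eq0 m_ge4 2 _) _; lia.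
have n21 : (2 == 1 :> 'Z_m) = false by apply: etrans (Zm_eq1 m_ge4 2 _) _; lia.
have n30 : (3 == 0 :> 'Z_m) = false by apply: etrans (Zm_eq0 m_ge4 3 _) _; lia.
have n31 : (3 == 1 :> 'Z_m) = false by apply: etrans (Zm_eq1 m_ge4 3 _) _; lia.
have n2N1 : (2 == -1 :> 'Z_m) = false.
  by apply: etrans (Zm_eqN1 m_ge4 2 _) _; lia.
rewrite !inE => /or4P[] /eqP->.
(* Here (y, w - 3) = (1, -3) lies on none of the three lines. *)
- have -> : (0, 1, 0) = vertex_at 1 (1, 0) :> vertex m.
    by rewrite /vertex_at /= subrr subr0.
  rewrite /Hdir sigma_vertex_at Fdir_vertex_at val1 /= pairB sigma_starE.
  have -> : 1 - 0 + (0 - 3) = - 2 :> 'Z_m by ring.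
  rewrite subr0 n10 sub0r !oppr_eq0 n30 n20 perm1.
  by case: (Z3P c) => ->; rewrite ?pi0 ?pi1 ?pi2.
- have -> : (1, 1, 0) = vertex_at 2 (1, 0) :> vertex m.
    by rewrite /vertex_at /=; congr (_, _, _); ring.
  rewrite /Hdir sigma_vertex_at Fdir_vertex_at val2 /=.
  by case: (Z3P c) => ->; rewrite ?pi0 ?pi1 ?pi2; apply: rot; apply: val_inj.
- have -> : (0, 0, 0) = vertex_at 0 (0, 0) :> vertex m.
    by rewrite /vertex_at /= !subr0.
  rewrite /Hdir sigma_vertex_at Fdir_vertex_at /= shift0.
  by case: (Z3P c) => ->; rewrite ?pi0 ?pi1 ?pi2; apply: rot; apply: val_inj.
(* Here (y, w - 3) = (-2, 0) lies on the last line, with parameter t = 2. *)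
have m2 : (m - 2)%:R = -2 :> 'Z_m by rewrite natrB ?m0 ?sub0r //; lia.
have -> : (0, (m - 2)%N%:R, 3) = vertex_at 1 (-2, 3) :> vertex m.
  by rewrite /vertex_at /= m2; congr (_, _, _); ring.
rewrite /Hdir sigma_vertex_at Fdir_vertex_at val1 /= n30 n31 pairB.
rewrite subr0 subrr sigma_starE.
rewrite eqxx oppr_eq0 n20 opprK /line_perm n21 n2N1.
by case: (Z3P c) => ->; rewrite ?pi0 ?pi1 ?pi2 permE /tau_fun; apply: val_inj.
Qed.

End Slices.

Theorem proposition7p2 (m : nat) (m_even : ~~ odd m) (m_ge4 : (4 <= m)%N) :
  [/\ hamilton_decomposition (@D3 m) (@H m),
      forall (v : vertex m) (d : direction),
        exists! c : color, H c v = v + evec m d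
    & forall (c : color) (v : vertex m), v \in Q m -> Hdir c v = Fdir c v].
Proof.
split; [ | exact: H_color | exact: agree_on_Q].
split=> [c|u v /existsP[d /eqP->]]; last exact: H_color.
split; [exact/injF_bij/H_inj | by move=> u v; apply: H_connected |].
by move=> v; apply/existsP; exists (Hdir c v).
Qed.
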